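(* For all positive integers $c,m,n$ with $m\le n$, the integer $h_c\left(\prod_{\ell=m}^{n}(\ell+\sqrt{-c})\right)$ divides $c\prod_{\ell=1}^{n-m}(\ell^2+4c)$.
   Context: Here $\sqrt{-c}=i\sqrt{c}$, and $h_c:\mathbb{Z}[\sqrt{-c}]\setminus\{0\}\to\mathbb{N}^*$ is the map $a+b\sqrt{-c}\mapsto\gcd(a,b)$ for $a,b\in\mathbb{Z}$ not both zero. An empty product equals $1$. *)

(* Defs.v *)
From HB Require Import structures.
From mathcomp Require Import all_boot all_order all_algebra all_field.
From mathcomp Require Import boolp ring.

Set Implicit Arguments.
Unset Strict Implicit.
Unset Printing Implicit Defensive.

Import Order.TTheory GRing.Theory Num.Theory.
Local Open Scope ring_scope.

Definition sqrtN (c : nat) : algC := 'i * sqrtC c%:R.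

Definition lincomb (c : nat) (p : int * int) : algC :=
  p.1%:~R + p.2%:~R * sqrtN c.

Definition Zsqrt_pred (c : nat) : {pred algC} :=
  fun z => `[< exists p, z == lincomb c p >].

Lemma sqrtN_sqr c : sqrtN c * sqrtN c = - c%:R.
Proof. by rewrite -expr2 exprMn sqrCi sqrtCK mulN1r. Qed.

Lemma Zsqrt_subring c : subring_closed (Zsqrt_pred c).
Proof.
split=> [|x y /asboolP[p /eqP->] /asboolP[q /eqP->]|
          x y /asboolP[p /eqP->] /asboolP[q /eqP->]].
- by apply/asboolP; exists (1, 0); rewrite /lincomb /= mul0r addr0.
- apply/asboolP; exists (p.1 - q.1, p.2 - q.2); apply/eqP.
  by rewrite /lincomb /= !rmorphB /= mulrBl opprD addrACA.
- apply/asboolP.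
  exists (p.1 * q.1 - c%:Z * (p.2 * q.2), p.1 * q.2 + p.2 * q.1); apply/eqP.
  rewrite /lincomb /= rmorphB !rmorphD !rmorphM /= -pmulrn.
  by have E := sqrtN_sqr c; ring: E.
Qed.

HB.instance Definition _ c :=
  GRing.isSubringClosed.Build algC (Zsqrt_pred c) (@Zsqrt_subring c).

(* The ring Z[sqrt(-c)], as a subring of the complex (algebraic) numbers. *)
Record Zsqrt (c : nat) :=
  MkZsqrt { Zsqrt_val : algC; _ : Zsqrt_val \in Zsqrt_pred c }.

HB.instance Definition _ c := [isSub for @Zsqrt_val c].
HB.instance Definition _ c := [Choice of Zsqrt c by <:].
HB.instance Definition _ c := [SubChoice_isSubComNzRing of Zsqrt c by <:].

Lemma sqrtN_in c : sqrtN c \in Zsqrt_pred c.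
Proof. by apply/asboolP; exists (0, 1); rewrite /lincomb /= add0r mul1r. Qed.

Definition Zsqrt_gen (c : nat) : Zsqrt c := MkZsqrt (sqrtN_in c).

Lemma Zsqrt_coordP c (z : Zsqrt c) : exists p, val z == lincomb c p.
Proof. exact/asboolP/(valP z). Qed.

(* The coordinates are unique only for c > 0, see [lincomb_inj]. *)
Definition coord (c : nat) (z : Zsqrt c) : int * int :=
  xchoose (Zsqrt_coordP z).

(* Total on Z[sqrt(-c)]: the extra value at 0 is gcd(0, 0) = 0. *)
Definition h (c : nat) (z : Zsqrt c) : nat :=
  gcdn `|(coord z).1|%N `|(coord z).2|%N.

Lemma lincomb_inj c : (0 < c)%N -> injective (lincomb c).
Proof.
move=> c_gt0 [a b] [a' b']; rewrite /lincomb /sqrtN /= => E.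
have s_gt0 : 0 < sqrtC c%:R :> algC by rewrite sqrtC_gt0 ltr0n.
have iR (k : int) : k%:~R \is @Num.real algC by rewrite realz.
have isR (k : int) : k%:~R * sqrtC c%:R \is @Num.real algC.
  by rewrite realM // gtr0_real.
rewrite !(mulrCA _ 'i) in E.
have := congr1 (fun z => 'Im z) E; rewrite !Im_rect //.
move/(mulIf (lt0r_neq0 s_gt0))/intr_inj=> ->.
by have := congr1 (fun z => 'Re z) E; rewrite !Re_rect // => /intr_inj ->.
Qed.

Lemma h_lincomb c (z : Zsqrt c) (a b : int) : (0 < c)%N ->
  val z = a%:~R + b%:~R * sqrtN c -> h z = gcdn `|a|%N `|b|%N.
Proof.
move=> c_gt0 zE; rewrite /h.
have /eqP := xchooseP (Zsqrt_coordP z); rewrite -/(coord z) zE.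
by move/(@lincomb_inj c c_gt0 (a, b)) => <-.
Qed.

Lemma h_gt0 c (z : Zsqrt c) : z != 0 -> (0 < h z)%N.
Proof.
apply: contraNT; rewrite -eqn0Ngt -leqn0 leqNgt gcdn_gt0 !absz_gt0 negb_or.
rewrite !negbK => /andP[/eqP a0 /eqP b0]; apply/eqP/val_inj.
have /eqP -> := xchooseP (Zsqrt_coordP z); rewrite -/(coord z).
by rewrite /lincomb a0 b0 mul0r addr0 rmorph0.
Qed.

(* Main.v *)
Require Import Defs.
From mathcomp Require Import all_boot all_order all_algebra all_field.
From mathcomp Require Import ring.

Import Order.TTheory GRing.Theory Num.Theory.
Local Open Scope ring_scope.

(** Let s = sqrt(-c), y = m - s, t = 2s and N = n - m. The product P is the rising
factorial of y + t of length N+1, and its conjugate is that of y. These two are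
polynomials in y with a Bezout identity u P - u' P' = t prod_(l=1)^N (t^2 - l^2).
Lagrange interpolation determines u; in Newton form its coefficients are divided
differences of 1/(z(z+1)...(z+N)), hence binomial coefficients up to products of
linear factors, so u lies in Z[s], and u' is its conjugate. Writing u = a + b s and
P = p + q s, the left-hand side is 2s (a q + b p), and cancelling t = 2s shows that
gcd(p, q) divides prod_(l=1)^N (l^2 + 4c). *)

Definition rising {R : comNzRingType} (x : R) (k : nat) : R :=
  \prod_(0 <= i < k) (x + i%:R).

(** The coefficient u in Newton form at the nodes 0, -1, ..., -N, for factors [rising (y + t) M.+1]
    and [rising y N.+1]. Keeping M and N independent makes an induction possible. *)
Definition bezout_coef {R : comNzRingType} (M N : nat) (y t : R) : R :=
  \sum_(0 <= k < N.+1) (-1) ^+ k * 'C(M + k, k)%:R * rising y k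
     * \prod_(k <= i < N) (t - i.+1%:R).

Lemma risingS (R : comNzRingType) (x : R) k :
  rising x k.+1 = rising x k * (x + k%:R).
Proof. by rewrite /rising big_nat_recr. Qed.

Lemma bezout_coefS (R : comNzRingType) (M N : nat) (y t : R) :
  bezout_coef M N.+1 y t = bezout_coef M N y t * (t - N.+1%:R)
    + (-1) ^+ N.+1 * 'C(M + N.+1, N.+1)%:R * rising y N.+1.
Proof.
rewrite /bezout_coef big_nat_recr //= [\prod_(N.+1 <= i < N.+1) _]big_geq // mulr1.
congr (_ + _); rewrite mulr_suml; apply: eq_big_nat => k /andP[_ lt_kN].
by rewrite big_nat_recr //= mulrA.
Qed.

Lemma bezout_coef0 (R : comNzRingType) (M : nat) (y t : R) :
  bezout_coef M 0 y t = 1.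
Proof.
by rewrite /bezout_coef big_nat1 big_geq // /rising big_geq // bin0 !mulr1.
Qed.

(** Lengthening [rising (y + t) M.+1] by the factor [t + y + M.+1] rescales the interpolated values;
    the multiple of [rising y N.+1] cancels the resulting term in y^(N+1). *)
Lemma bezout_coef_recM (R : comNzRingType) (M N : nat) (y t : R) :
  (t + M.+1%:R) * bezout_coef M N y t
    = (t + y + M.+1%:R) * bezout_coef M.+1 N y t
      + (-1) ^+ N.+1 * 'C(M + N.+1, N)%:R * rising y N.+1.
Proof.
elim: N => [|N IHN].
  by rewrite !bezout_coef0 bin0 risingS /rising big_geq //; ring.
rewrite !bezout_coefS mulrDr mulrA IHN (risingS _ y N.+1).
have pascal : 'C(M.+1 + N.+1, N.+1)%:R
    = 'C(M + N.+1, N.+1)%:R + 'C(M + N.+1, N)%:R :> R.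
  by rewrite addSn binS natrD.
have diag : N.+1%:R * 'C(M.+1 + N.+1, N.+1)%:R
    = (M%:R + 1 + (N%:R + 1)) * 'C(M + N.+1, N)%:R :> R.
  rewrite addSn -natrM -mul_bin_diag natrM; congr (_ * _).
  by rewrite -addSn natrD -!natr1.
rewrite (_ : (M + N.+2 = M.+1 + N.+1)%N); last by rewrite addnS addSn.
move: diag; rewrite pascal -!natr1 !exprS.
set a := 'C(M + N.+1, N.+1)%:R; set b := 'C(M + N.+1, N)%:R.
move=> diag; move: (rising _ _) (bezout_coef _ _ _ _) => q B.
(* This is (N+1) a = (M+1) b, obtained from [pascal] and [diag], with one monomial isolated for
   [ring]. *)
have diag' : N%:R * a = (M%:R + 1) * b - a.
  apply: (addIr (a + (N%:R + 1) * b)); rewrite [RHS]addrA subrK -mulrDl -diag.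
  by ring.
ring: diag'.
Qed.

Lemma bezout_rising (R : comNzRingType) (M N : nat) (y t : R) :
  t * \prod_(0 <= i < M) (t + i.+1%:R) * \prod_(0 <= i < N) (t - i.+1%:R)
  = bezout_coef M N y t * rising (y + t) M.+1
    + (-1) ^+ (M + N).+1 * bezout_coef N M (y + t) (- t) * rising y N.+1.
Proof.
elim: M => [|M IHM].
  rewrite [X in t * X]big_geq // mulr1 bezout_coef0 add0n mulr1.
  rewrite [rising (y + t) 1]risingS /rising [X in X * (y + t + _)]big_geq //.
  rewrite -/(rising y N.+1); elim: N => [|N IHN].
    by rewrite bezout_coef0 big_geq // risingS /rising big_geq //; ring.
  rewrite big_nat_recr //= mulrA IHN bezout_coefS add0n binn.
  by rewrite (risingS _ _ N.+1) -!natr1 !exprS; ring.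
rewrite big_nat_recr //=.
rewrite (_ : _ * _ * _ = (t + M.+1%:R)
  * (t * \prod_(0 <= i < M) (t + i.+1%:R) * \prod_(0 <= i < N) (t - i.+1%:R)));
  last by ring.
(* The recurrence in M supplies the new factor of [rising (y + t)] and leaves a multiple of
   [rising (y + t) M.+1 * rising y N.+1]. The last summand of the lengthened second coefficient is
   the same term, by symmetry of binomials and the sign rule [sq]. *)
rewrite IHM mulrDr mulrA bezout_coef_recM bezout_coefS [in RHS]risingS.
rewrite (_ : 'C(N + M.+1, M.+1) = 'C(M + N.+1, N)); last first.
  by rewrite -(addSnnS M N) -(bin_sub (leq_addl M.+1 N)) addnK addnC.
rewrite !addSn -!natr1 !exprS !exprD.
have sq : (-1) ^+ M * (-1) ^+ M = 1 :> R by rewrite -expr2 sqrr_sign.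
ring: sq.
Qed.

Lemma bezout_rising_diag (R : comNzRingType) (N : nat) (y t : R) :
  t * \prod_(1 <= l < N.+1) (t ^+ 2 - (l ^ 2)%:R)
  = bezout_coef N N y t * rising (y + t) N.+1
    - bezout_coef N N (y + t) (- t) * rising y N.+1.
Proof.
have := bezout_rising R N N y t.
rewrite exprS exprD -expr2 sqrr_sign mulr1 mulN1r mulNr => <-.
rewrite -mulrA -big_split big_add1 /=; congr (_ * _); apply: eq_bigr => i _.
by rewrite natrX; ring.
Qed.

Lemma conj_sqrtN c : (sqrtN c)^* = - sqrtN c.
Proof.
by rewrite rmorphM /= conjCi geC0_conj ?sqrtC_ge0 ?ler0n // mulNr.
Qed.

Lemma conj_lincomb c (p : int * int) :
  (lincomb c p)^* = p.1%:~R - p.2%:~R * sqrtN c.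
Proof.
by rewrite rmorphD (rmorphM _ p.2%:~R) /= !rmorph_int conj_sqrtN mulrN.
Qed.

Lemma rising_rmorph (R S : comNzRingType) (f : {rmorphism R -> S}) x k :
  f (rising x k) = rising (f x) k.
Proof.
by rewrite rmorph_prod; apply: eq_bigr => i _; rewrite rmorphD rmorph_nat.
Qed.

Lemma bezout_coef_rmorph (R S : comNzRingType) (f : {rmorphism R -> S}) M N y t :
  f (bezout_coef M N y t) = bezout_coef M N (f y) (f t).
Proof.
rewrite rmorph_sum; apply: eq_bigr => k _.
rewrite !rmorphM rmorph_sign rmorph_nat rising_rmorph rmorph_prod.
by congr (_ * _); apply: eq_bigr => i _; rewrite rmorphB rmorph_nat.
Qed.

Lemma h_dvd_of_conj (c : nat) (z u : Zsqrt c) (d : int) : (0 < c)%N ->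
  2 * sqrtN c * d%:~R = val u * val z - (val u)^* * (val z)^* ->
  (h z %| `|d|)%N.
Proof.
move=> c_gt0; have [[a b] /eqP uE] := Zsqrt_coordP u.
(* For z the coordinates must be the ones chosen inside [h]; for u any pair will do. *)
have /eqP zE := xchooseP (Zsqrt_coordP z); rewrite -/(Defs.coord z) in zE.
rewrite /h; move: (Defs.coord z) zE => [p q] zE.
rewrite zE uE !conj_lincomb /lincomb /= => E.
have s_neq0 : 2 * sqrtN c != 0.
  by rewrite !mulf_neq0 ?pnatr_eq0 ?neq0Ci // sqrtC_eq0 pnatr_eq0 -lt0n.
have -> : d = a * q + b * p.
  apply: (@intr_inj algC); apply: (mulfI s_neq0).
  by rewrite E rmorphD !rmorphM /=; ring.
rewrite -[X in (X %| _)%N]/(absz (gcdz p q)) -dvdzE.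
by rewrite rpredD // dvdz_mull // ?dvdz_gcdl ?dvdz_gcdr.
Qed.

Theorem theorem3 (c m n : nat) (c_gt0 : (0 < c)%N) (m_gt0 : (0 < m)%N)
    (n_gt0 : (0 < n)%N) (le_mn : (m <= n)%N) :
  (h (\prod_(m <= l < n.+1) (l%:R + Zsqrt_gen c))%R
     %| c * \prod_(1 <= l < (n - m).+1) (l ^ 2 + 4 * c))%N.
Proof.
apply: dvdn_mull.
set N := (n - m)%N; set s := Zsqrt_gen c.
pose y : Zsqrt c := m%:R - s; pose t : Zsqrt c := 2 * s.
have -> : \prod_(m <= l < n.+1) (l%:R + s) = rising (y + t) N.+1.
  rewrite -{1}[m]add0n big_addn subSn // -/N; apply: eq_bigr => i _.
  by rewrite natrD /y /t; ring.
(* Each t^2 - l^2 equals -(l^2 + 4c), whence the sign (-1)^N, which the absolute value removes. *)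
have := @h_dvd_of_conj c (rising (y + t) N.+1) (bezout_coef N N y t)
  ((-1) ^+ N * (\prod_(1 <= l < N.+1) (l ^ 2 + 4 * c))%:Z) c_gt0.
rewrite abszM abszX exp1n mul1n; apply.
have tE : val t = 2 * sqrtN c by rewrite rmorphM rmorph_nat.
have yE : val y = m%:R - sqrtN c by rewrite rmorphB rmorph_nat.
clearbody y t.
(* Conjugation maps (y, t) to (y + t, -t), so it carries the first term of [bezout_rising_diag] to
   the second. *)
have tC : (val t)^* = - val t by rewrite tE rmorphM /= rmorph_nat conj_sqrtN mulrN.
have yC : (val y)^* = val y + val t.
  by rewrite yE tE rmorphB /= rmorph_nat conj_sqrtN; ring.
rewrite !rising_rmorph !bezout_coef_rmorph rmorphD /= [in RHS]rmorphD /= yC tC.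
rewrite addrK -bezout_rising_diag -tE; congr (_ * _).
rewrite rmorphM rmorph_sign /= -pmulrn natr_prod.
rewrite !big_add1 /= -{1}[N]subn0 -prodr_const_nat -big_split /=.
apply: eq_bigr => i _; rewrite tE exprMn expr2 [sqrtN c ^+ 2]sqrtN_sqr.
by rewrite natrD natrM; ring.
Qed.
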